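(* The function $p\mapsto\rho^*(p)$ is strictly decreasing on $(0,1]$.
   Context: Definition of $\rho^*(p)$ for $p\in(0,1]$: let $X\sim N(0,1)$, and let $f$ and $F$ denote the probability density function and cumulative distribution function of $|X|$. Let $z^*=z^*(p)\in(0,\infty)$ be the (unique) number with $\int_0^{z^*}x^pf(x)\,dx-\int_{z^*}^\infty x^pf(x)\,dx=0$, and put $\rho^*(p):=1-F(z^* )$. *)

(* Defs.v *)
From HB Require Import structures.
From mathcomp Require Import all_boot all_order all_algebra.
From mathcomp Require Import all_classical all_reals all_analysis.
Import Order.TTheory GRing.Theory Num.Theory.
Import numFieldNormedType.Exports.

Set Implicit Arguments.
Unset Strict Implicit.
Unset Printing Implicit Defensive.

Local Open Scope classical_set_scope.
Local Open Scope ring_scope.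

Section abs_rv.
Context d (T : measurableType d) (R : realType) (P : probability T R).
Variable X : {RV P >-> R}.

Definition abs_rv_fun : T -> R := fun t => `|X t|.

Lemma measurable_abs_rv_fun : measurable_fun [set: T] abs_rv_fun.
Proof. by apply: measurableT_comp => //; exact: measurable_funP. Qed.

HB.instance Definition _ :=
  isMeasurableFun.Build _ _ T R abs_rv_fun measurable_abs_rv_fun.

Definition abs_rv : {RV P >-> R} := abs_rv_fun.

End abs_rv.

Definition standard_normal d (T : measurableType d) (R : realType)
    (P : probability T R) (X : {RV P >-> R}) : Prop :=
  forall A : set R, measurable A -> distribution P X A = normal_prob 0 1 A.

(* A density is only determined up to a Lebesgue-null set, hence a predicate. *)
Definition is_pdf d (T : measurableType d) (R : realType)
    (P : probability T R) (Y : {RV P >-> R}) (f : R -> R) : Prop :=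
  [/\ measurable_fun [set: R] f,
      forall x, 0 <= f x &
      forall A : set R, measurable A ->
        distribution P Y A = (\int[lebesgue_measure]_(x in A) (f x)%:E)%E].

(* The difference is taken in the extended reals, where
   +oo - +oo = -oo, so a solution has both integrals finite and equal. *)
Definition is_zstar (R : realType) (f : R -> R) (p z : R) : Prop :=
  0 < z /\
  (\int[lebesgue_measure]_(x in `[0%R, z]) (x `^ p * f x)%:E
   - \int[lebesgue_measure]_(x in `[z, +oo[) (x `^ p * f x)%:E = 0)%E.

(* 0 is a junk value, excluded by [is_zstar], for when there is no solution. *)
Definition zstar (R : realType) (f : R -> R) (p : R) : R :=
  xget 0 [set z | is_zstar f p z].

Definition rho_star d (T : measurableType d) (R : realType)
    (P : probability T R) (Y : {RV P >-> R}) (f : R -> R) (p : R) : R :=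
  1 - fine (cdf Y (zstar f p)).

(* Main.v *)
(* Write r = q - p > 0 and z = zstar f p. As x^q = x^r x^p, with x^r < z^r below z
   and x^r > z^r above it, the balance of x^p f at z makes the integral of x^q f
   over [0, z] smaller than the one over [z, +oo[, so that zstar f q > z, and the
   cdf of |X| is strictly increasing on [0, +oo[. Solutions of the balance
   equation exist by the intermediate value theorem, E[|X|^p] being finite. *)
Require Import Defs.
From mathcomp Require Import all_boot all_order all_algebra.
From mathcomp Require Import all_classical all_reals all_analysis.
From mathcomp Require Import measurable_realfun ring lra.
Import Order.TTheory GRing.Theory Num.Theory.
Import numFieldNormedType.Exports.

Set Implicit Arguments.
Unset Strict Implicit.

Local Open Scope classical_set_scope.
Local Open Scope ring_scope.

(** * Densities and expectations *)

(** [f] and the Radon-Nikodym derivative of [nu] have the same integral over every measurable set,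
    so they agree [mu]-almost everywhere, and the change of variables for the derivative carries
    over to [f]. *)
Lemma ge0_integral_density d (T : measurableType d) (R : realType)
    (nu : {finite_measure set T -> \bar R})
    (mu : {sigma_finite_measure set T -> \bar R}) (f : T -> R)
    (h : T -> \bar R) :
  measurable_fun [set: T] f -> (forall x, 0 <= f x) ->
  (forall A, measurable A -> nu A = (\int[mu]_(x in A) (f x)%:E)%E) ->
  measurable_fun [set: T] h -> (forall x, 0 <= h x)%E ->
  (\int[mu]_x (h x * (f x)%:E) = \int[nu]_x h x)%E.
Proof.
move=> mf f0 nuf mh h0.
have numu : nu `<< mu.
  apply/null_content_dominatesP => A mA A0.
  rewrite nuf//; apply: null_set_integral => //.
  by apply/measurable_funTS/measurable_EFinP.
rewrite -(Radon_Nikodym_SigmaFinite.change_of_variables numu)//.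
have mRN : measurable_fun [set: T] (Radon_Nikodym_SigmaFinite.f nu mu).
  exact: measurable_int (Radon_Nikodym_SigmaFinite.f_integrable numu).
apply: ge0_ae_eq_integral => //.
- by apply: emeasurable_funM => //; exact/measurable_EFinP.
- exact: emeasurable_funM.
- by move=> x _; rewrite mule_ge0// lee_fin.
- by move=> x _; rewrite mule_ge0// Radon_Nikodym_SigmaFinite.f_ge0.
have : ae_eq mu [set: T] (Radon_Nikodym_SigmaFinite.f nu mu) (EFin \o f).
  apply: integral_ae_eq => //.
  - exact: Radon_Nikodym_SigmaFinite.f_integrable.
  - exact/measurable_EFinP.
  - by move=> A _ mA; rewrite -Radon_Nikodym_SigmaFinite.f_integral// nuf.
by apply: filterS => x /= + _ => ->.
Qed.

(** Moments under the density of $|X|$ and under the normal density both become expectations over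
    [P], where they can be compared pointwise. *)
Lemma ge0_integral_pdf d (T : measurableType d) (R : realType)
    (P : probability T R) (X : {RV P >-> R}) (f : R -> R) (h : R -> \bar R) :
  is_pdf X f -> measurable_fun [set: R] h -> (forall x, 0 <= h x)%E ->
  (\int[lebesgue_measure]_x (h x * (f x)%:E) = \int[P]_t h (X t))%E.
Proof.
move=> [mf f0 fE] mh h0.
(* [lebesgue_measure] lives on [measurableTypeR R], whose display differs from
   that of [R]. *)
have mY : measurable_fun (U := measurableTypeR R) [set: T] X.
  by move=> mT B mB; apply: (@measurable_funPT _ _ _ _ X).
pose Y : {RV P >-> measurableTypeR R} :=
  @mfun_Sub _ _ T (measurableTypeR R) X (mem_set mY).
rewrite (@ge0_integral_density _ _ _ (distribution P Y) lebesgue_measure)//.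
by rewrite ge0_integral_distribution.
Qed.

(** The weight $1 + |x|$ dominates $|x|^p$ for all $p$ in $(0,1]$ at once. *)
Lemma normal_abs_moment_lty (R : realType) :
  (\int[lebesgue_measure]_x ((1 + `|x|)%:E * (normal_pdf (0:R) 1 x)%:E) < +oo)%E.
Proof.
have mh : measurable_fun [set: R] (fun x : R => 1 + `|x|).
  by apply: measurable_funD => //; exact: measurableT_comp.
pose s : R := Num.sqrt 2.
have s2 : s ^+ 2 = 2 by rewrite sqr_sqrtr.
have s0 : s != 0 by rewrite gt_eqF// sqrtr_gt0.
(* [1 + |x| <= 2 exp(x^2 / 4)], so that the centered normal density with variance
   2 dominates the integrand up to a constant. *)
pose C := 2 * normal_peak (1:R) / normal_peak s.
have C0 : 0 <= C by rewrite !mulr_ge0 ?invr_ge0 ?normal_peak_ge0.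
apply: (@le_lt_trans _ _ (\int[lebesgue_measure]_x (C%:E * (normal_pdf 0 s x)%:E))%E).
  apply: ge0_le_integral => //=.
  - by move=> x _; rewrite lee_fin mulr_ge0// ?addr_ge0// normal_pdf_ge0.
  - apply/measurable_EFinP; apply: measurable_funM => //.
    exact: measurable_normal_pdf.
  - apply/measurable_EFinP; apply: measurable_funM => //.
    exact: measurable_normal_pdf.
  move=> x _; rewrite -EFinM lee_fin !normal_pdfE ?oner_neq0// /normal_fun.
  rewrite !subr0 s2 expr1n.
  have -> : C * (normal_peak s * expR (- x ^+ 2 / (2 *+ 2))) =
      normal_peak (1:R) * (2 * expR (- x ^+ 2 / (2 *+ 2))).
    rewrite /C; field.
    by rewrite gt_eqF// normal_peak_gt0.
  rewrite mulrCA ler_wpM2l ?normal_peak_ge0//.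
  have -> : - x ^+ 2 / (1 *+ 2) = - x ^+ 2 / (2 *+ 2) + - (x ^+ 2 / 4) :> R by field.
  rewrite expRD mulrCA mulrC ler_wpM2r ?expR_ge0// expRN ler_pdivrMr ?expR_gt0//.
  (* $1 + |x| \le 2 (1 + x^2/4)$, the difference being $((|x| - 1)^2 + 1)/2$. *)
  have := expR_ge1Dx (x ^+ 2 / 4).
  by rewrite -real_normK ?num_real//; nra.
rewrite integralZl//; last exact: integrable_normal_pdf.
by rewrite integral_normal_pdf mule1 ltry.
Qed.

(** * The balance equation *)

(** The running integral [H] is continuous, starts at 0 and tends to the total mass [M], so it takes
    the value [M / 2]; the remaining mass is then [M / 2] too. *)
Lemma exists_integral_balance (R : realType) (g : R -> R) :
  lebesgue_measure.-integrable `[0, +oo[ (EFin \o g) ->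
  (forall x, 0 <= g x) ->
  (0 < \int[lebesgue_measure]_(x in `[0%R, +oo[) (g x)%:E)%E ->
  exists2 z, 0 < z &
    (\int[lebesgue_measure]_(x in `[0%R, z]) (g x)%:E
     - \int[lebesgue_measure]_(x in `[z, +oo[) (g x)%:E = 0)%E.
Proof.
move=> ig g0 M0; set mu := lebesgue_measure.
have mg : measurable_fun (`[0, +oo[ : set R) (EFin \o g) by exact: measurable_int ig.
have sub (b : R) : `[0%R, b] `<=` `[0%R, +oo[ by apply: subset_itvl; rewrite bnd_simp.
have fin (A : set R) : measurable A -> A `<=` `[0%R, +oo[ ->
    (\int[mu]_(x in A) (g x)%:E)%E \is a fin_num.
  by move=> mA As; apply: integrable_fin_num => //; exact: integrableS ig.
pose H b := \int[mu]_(x in `[0, b]) g x.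
have HE b : (\int[mu]_(x in `[0%R, b]) (g x)%:E)%E = (H b)%:E.
  by rewrite /H /Rintegral fineK// fin.
pose M := \int[mu]_(x in `[0, +oo[) g x.
have ME : (\int[mu]_(x in `[0%R, +oo[) (g x)%:E)%E = M%:E.
  by rewrite /M /Rintegral fineK// fin.
have M_gt0 : 0 < M by rewrite -lte_fin -ME.
(* The intermediate value theorem needs a bounded interval; monotone convergence gives a right end
   at which [H] has passed [M / 2]. *)
have [N _ HN] : \forall n \near \oo, M / 2 < H n%:R.
  have cH : (\int[mu]_(x in `[0%R, n%:R]) (g x)%:E)%E @[n --> \oo] --> M%:E.
    rewrite -ME.
    have -> : [set` `[0, +oo[] = \bigcup_n [set` `[0:R, n%:R]].
      by rewrite itv_bndy_bigcup_BRight; apply: eq_bigcupr => n _; rewrite add0r.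
    apply: (@ge0_nondecreasing_set_cvg_integral _ (measurableTypeR R) R
      (fun n => [set` `[0, n%:R]]) (EFin \o g) mu) => //.
    - move=> m n mn; rewrite subsetEset; apply: subset_itvl.
      by rewrite bnd_simp ler_nat.
    - by move=> n; apply: measurable_funS mg => //; exact: sub.
    - by move=> n x _; rewrite lee_fin.
  have {}cH : H n%:R @[n --> \oo] --> M by exact: fine_cvg cH.
  by apply: cvgr_gt cH _ _; rewrite ltr_pdivrMr// ltr_pMr// ltr1n.
have H0 : H 0 = 0 by rewrite /H set_itv1 Rintegral_set1.
have N0 : 0 <= N%:R :> R by [].
have [c cN Hc] : exists2 c, c \in `[0, N%:R] & H c = M / 2.
  apply: IVT => //.
    by apply: parameterized_integral_continuous => //; exact: integrableS ig.
  have HNN := HN N (leqnn N).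
  rewrite H0 ge_min le_max (ltW HNN) orbT andbT.
  by rewrite divr_ge0// ltW.
have c0 : 0 < c.
  move: cN; rewrite in_itv/= => /andP[c0 _].
  rewrite lt_neqAle c0 andbT; apply/eqP => c00.
  by move: Hc; rewrite -c00 H0 => /esym/eqP; rewrite gt_eqF// divr_gt0.
exists c => //.
have -> : (\int[mu]_(x in `[c, +oo[) (g x)%:E = (M / 2)%:E)%E.
  have mcy : measurable_fun (`[c, +oo[ : set R) (EFin \o g).
    by apply: measurable_funS mg => //; apply: subset_itvr; rewrite bnd_simp ltW.
  (* Dropping the null set $\{c\}$ makes the two intervals disjoint. *)
  rewrite -integral_itv_obnd_cbnd; last first.
    by apply: measurable_funS mcy => //; apply: subset_itvr; rewrite bnd_simp.
  have scy : `]c, +oo[ `<=` `[0, +oo[.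
    by apply: subset_itvr; rewrite bnd_simp ltW.
  have : (\int[mu]_(x in `[0%R, c]) (g x)%:E
      + \int[mu]_(x in `]c, +oo[) (g x)%:E = M%:E)%E.
    rewrite -ME -ge0_integral_setU//.
    + by rewrite -itv_bndbnd_setU// bnd_simp// ltW.
    + by rewrite -itv_bndbnd_setU// bnd_simp// ltW.
    + by move=> x _; rewrite lee_fin.
    + apply/disj_setPS => x [] /=; rewrite !in_itv/= andbT => /andP[_ xc].
      by rewrite ltNge xc.
  rewrite HE Hc -(@fineK _ (\int[mu]_(x in `]c, +oo[) _)%E) ?fin//.
  by rewrite -EFinD => -[MM]; congr EFin; lra.
by rewrite HE Hc subee.
Qed.

(** An extended difference with an infinite term is infinite, never 0, so both integrals are
    real. *)
Lemma is_zstarP (R : realType) (f : R -> R) (p z : R) :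
  (forall x, 0 <= f x) -> is_zstar f p z ->
  0 < z /\ exists I : R,
    (\int[lebesgue_measure]_(x in `[0%R, z]) (x `^ p * f x)%:E = I%:E)%E /\
    (\int[lebesgue_measure]_(x in `[z, +oo[) (x `^ p * f x)%:E = I%:E)%E.
Proof.
move=> f0 [z0]; set a := integral _ _ _; set b := integral _ _ _ => ab.
split => //; move: ab.
case: a b => [a| |] [b| |]//= /eqP.
by rewrite -EFinB eqe subr_eq0 => /eqP <-; exists a.
Qed.

(** * Comparison of two exponents *)

Section powR_weight.
Context {R : realType} {f : R -> R}.
Hypothesis mf : measurable_fun [set: R] f.
Hypothesis f0 : forall x, 0 <= f x.
Implicit Types p q z w c : R.

Let mu := @lebesgue_measure R.

Lemma measurable_powRM p (D : set R) :
  measurable_fun D (fun x => (x `^ p * f x)%:E).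
Proof.
by apply/measurable_funTS/measurable_EFinP; apply: measurable_funM.
Qed.

Let powRM_ge0 p x : (0 <= (x `^ p * f x)%:E)%E.
Proof. by rewrite lee_fin mulr_ge0// powR_ge0. Qed.

Lemma integral_powR_le p q c (D : set R) : 0 < p -> p < q -> measurable D ->
  D `<=` `[0, c] ->
  (\int[mu]_(x in D) (x `^ q * f x)%:E
   <= (c `^ (q - p))%:E * \int[mu]_(x in D) (x `^ p * f x)%:E)%E.
Proof.
move=> p0 pq mD Dc.
rewrite -ge0_integralZl_EFin//; [|exact: measurable_powRM|exact: powR_ge0].
apply: ge0_le_integral => //.
- exact: measurable_powRM.
- by apply: measurable_funeM; exact: measurable_powRM.
move=> x /Dc /=; rewrite in_itv/= => /andP[x0 xc].
rewrite -EFinM lee_fin mulrA ler_wpM2r//.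
(* At 0 the left side vanishes because [q] is positive; elsewhere $x^q$ factors. *)
have [->|xn0] := eqVneq x 0.
  by rewrite powR0 ?gt_eqF ?(lt_trans p0)// mulr_ge0// powR_ge0.
have -> : x `^ q = x `^ (q - p) * x `^ p.
  by rewrite -powRD ?subrK// xn0 implybT.
rewrite ler_wpM2r ?powR_ge0//.
by rewrite ge0_ler_powR ?nnegrE ?subr_ge0 ?(ltW pq)//; exact: le_trans xc.
Qed.

Lemma integral_powR_ge p q c (D : set R) : p < q -> 0 < c -> measurable D ->
  D `<=` `[c, +oo[ ->
  ((c `^ (q - p))%:E * \int[mu]_(x in D) (x `^ p * f x)%:E
   <= \int[mu]_(x in D) (x `^ q * f x)%:E)%E.
Proof.
move=> pq c0 mD Dc.
rewrite -ge0_integralZl_EFin//; [|exact: measurable_powRM|exact: powR_ge0].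
apply: ge0_le_integral => //.
- by move=> x _; rewrite mule_ge0// lee_fin powR_ge0.
- by apply: measurable_funeM; exact: measurable_powRM.
- exact: measurable_powRM.
move=> x /Dc /=; rewrite in_itv/= andbT => cx.
rewrite -EFinM lee_fin mulrA ler_wpM2r//.
have x0 : 0 < x by exact: lt_le_trans cx.
have -> : x `^ q = x `^ (q - p) * x `^ p.
  by rewrite -powRD ?subrK//; apply/implyP => _; rewrite gt_eqF.
rewrite ler_wpM2r ?powR_ge0//.
by apply: ge0_ler_powR => //; rewrite ?nnegrE ?subr_ge0 ltW.
Qed.

(** Values of a density are fixed only almost everywhere, so positivity is asked of its
    integrals. *)
Hypothesis f_gt0 : forall a b : R, 0 < a -> a < b ->
  (0 < \int[mu]_(x in `[a, b]) (f x)%:E)%E.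

Lemma integral_powR_gt0 p a b : 0 < p -> 0 < a -> a < b ->
  (0 < \int[mu]_(x in `[a, b]) (x `^ p * f x)%:E)%E.
Proof.
move=> p0 a0 ab.
(* With lower exponent 0 this bounds the integral below by $a^p$ times that of [f]. *)
have /= := @integral_powR_ge 0 p a `[a, b] p0 a0.
rewrite subr0.
have -> : (\int[mu]_(x in `[a, b]) (x `^ 0 * f x)%:E)%E = (\int[mu]_(x in `[a, b]) (f x)%:E)%E.
  by apply: eq_integral => x _; rewrite powRr0 mul1r.
move=> H; apply: lt_le_trans (H _ _) => //.
  by rewrite mule_gt0 ?f_gt0// lte_fin powR_gt0.
by apply: subset_itvl; rewrite bnd_simp.
Qed.

(** If $w \le z$, then $J \le \int_0^z x^q f < z^{q-p} I \le \int_z^\infty x^q f \le J$, a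
    contradiction. *)
Lemma is_zstar_lt p q z w : 0 < p -> p < q ->
  is_zstar f p z -> is_zstar f q w -> z < w.
Proof.
move=> p0 pq /(is_zstarP f0)[z0 [I [AI BI]]] /(is_zstarP f0)[w0 [J [AJ BJ]]].
rewrite ltNge; apply/negP => wz.
have z20 : 0 < z / 2 by rewrite divr_gt0.
have z2z : z / 2 < z by rewrite ltr_pdivrMr// ltr_pMr// ltr1n.
pose r := q - p.
have r0 : 0 < r by rewrite subr_gt0.
(* Cutting [[0, z]] at [z / 2] gives a strict inequality, since
   [x `^ r <= (z / 2) `^ r < z `^ r] on the left part, where the integral is
   positive. *)
have split s : (\int[mu]_(x in `[0%R, z]) (x `^ s * f x)%:E =
    \int[mu]_(x in `[0%R, (z / 2)%R]) (x `^ s * f x)%:E +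
    \int[mu]_(x in `](z / 2)%R, z]) (x `^ s * f x)%:E)%E.
  rewrite -ge0_integral_setU//.
  - by rewrite -itv_bndbnd_setU// bnd_simp ltW.
  - exact: measurable_powRM.
  - apply/disj_setPS => x [] /=; rewrite !in_itv/= => /andP[_ xc].
    by rewrite ltNge xc.
have := split p; rewrite AI.
set a1 := (X in (X + _)%E); set a2 := (X in (_ + X)%E) => I12.
(* [f_gt0] wants a positive left end, hence the smaller interval from [z / 4]. *)
have a10 : (0 < a1)%E.
  apply: (@lt_le_trans _ _ (\int[mu]_(x in `[(z / 4)%R, (z / 2)%R]) (x `^ p * f x)%:E)%E).
    by apply: integral_powR_gt0 => //; lra.
  apply: ge0_subset_integral => //; first exact: measurable_powRM.
  by apply: subset_itvr; rewrite bnd_simp; lra.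
have a20 : (0 <= a2)%E by apply: integral_ge0.
have J1 : (J%:E <= ((z / 2) `^ r)%:E * a1 + (z `^ r)%:E * a2)%E.
  rewrite -AJ.
  apply: (@le_trans _ _ (\int[mu]_(x in `[0%R, z]) (x `^ q * f x)%:E)%E).
    apply: ge0_subset_integral => //; first exact: measurable_powRM.
    by apply: subset_itvl; rewrite bnd_simp.
  rewrite split; apply: leeD; apply: integral_powR_le => //.
  by apply: subset_itvr; rewrite bnd_simp ltW.
have J2 : ((z `^ r)%:E * I%:E <= J%:E)%E.
  rewrite -BI -BJ.
  apply: (@le_trans _ _ (\int[mu]_(x in `[z, +oo[) (x `^ q * f x)%:E)%E).
    exact: integral_powR_ge.
  apply: ge0_subset_integral => //; first exact: measurable_powRM.
  by apply: subset_itvr; rewrite bnd_simp.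
have : (z / 2) `^ r < z `^ r by rewrite gt0_ltr_powR ?nnegrE ?ltW.
(* As [a1 + a2] is the real [I], the bounds reduce to $z^r a_1 \le (z/2)^r a_1$, which $a_1 > 0$
   forbids. *)
move: (le_trans J2 J1) I12 a10 a20 => {J1}.
case: a1 a2 => [a1| |] [a2| |]//.
rewrite -!EFinM -!EFinD lee_fin => cI [I12]; rewrite lte_fin lee_fin.
by move: cI; rewrite I12; nra.
Qed.
End powR_weight.

(** * The law of $|X|$ *)

(** On the interval the density is at least its value [c] at $\max(|a|, |b|)$, which is positive. *)
Lemma normal_prob_itv_gt0 (R : realType) (a b : R) : a < b ->
  (0 < normal_prob (0:R) 1 `]a, b])%E.
Proof.
move=> ab; pose m := Num.max `|a| `|b|.
pose c := normal_peak (1:R) * expR (- m ^+ 2 / (1 ^+ 2 *+ 2)).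
have c0 : 0 < c by rewrite mulr_gt0 ?expR_gt0// normal_peak_gt0// oner_neq0.
apply: (@lt_le_trans _ _ (\int[lebesgue_measure]_(x in `]a, b]) c%:E)%E).
  rewrite integral_cst//= lebesgue_measure_itv/= lte_fin ab -EFinB -EFinM.
  by rewrite lte_fin mulr_gt0// subr_gt0.
apply: ge0_le_integral => //.
- by move=> x _; rewrite lee_fin ltW.
- by apply/measurable_funTS/measurable_EFinP; exact: measurable_normal_pdf.
move=> x /=; rewrite in_itv/= => /andP[ax xb].
rewrite lee_fin normal_pdfE ?oner_neq0// ler_wpM2l ?normal_peak_ge0//.
rewrite /normal_fun subr0 ler_expR ler_wpM2r// lerN2.
rewrite -(real_normK (num_real x)) lerXn2r ?nnegrE//.
  by rewrite le_max normr_ge0.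
have [x0|x0] := leP 0 x; rewrite le_max; apply/orP; [right|left].
  by rewrite ger0_norm// (le_trans xb)// ler_norm.
by rewrite ltr0_norm// -normrN (le_trans _ (ler_norm _))// lerN2 ltW.
Qed.

Section abs_normal.
Context {d : measure_display} {T : measurableType d} {R : realType}.
Context {P : probability T R} {X : {RV P >-> R}}.
Hypothesis hX : standard_normal X.

Lemma is_pdf_normal : is_pdf X (normal_pdf 0 1).
Proof.
split; [exact: measurable_normal_pdf|exact: normal_pdf_ge0|exact: hX].
Qed.

Lemma distribution_abs_normal_itv_gt0 (a b : R) : 0 <= a -> a < b ->
  (0 < distribution P (abs_rv X) `]a, b])%E.
Proof.
move=> a0 ab; apply: lt_le_trans (normal_prob_itv_gt0 ab) _.
rewrite -hX//; apply: (@le_measure _ _ _ P); rewrite ?inE//.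
- by rewrite -[_ @^-1` _]setTI; exact: measurable_funP.
- by rewrite -[_ @^-1` _]setTI; exact: measurable_funP.
move=> t /=; rewrite !in_itv/= => /andP[aX Xb].
by rewrite /abs_rv_fun ger0_norm ?aX// (le_trans a0)// ltW.
Qed.

Lemma cdf_abs_normal_lt (a b : R) : 0 <= a -> a < b ->
  fine (cdf (abs_rv X) a) < fine (cdf (abs_rv X) b).
Proof.
move=> a0 ab; rewrite -lte_fin !fineK ?fin_num_measure//.
have -> : (cdf (abs_rv X) b =
    cdf (abs_rv X) a + distribution P (abs_rv X) `]a, b])%E.
  rewrite /cdf -measureU//.
  - by rewrite -itv_bndbnd_setU// bnd_simp ltW.
  - rewrite -subset0 => x [] /=; rewrite !in_itv/= => xa /andP[].
    by rewrite ltNge xa.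
by rewrite lteDl ?distribution_abs_normal_itv_gt0// fin_num_measure.
Qed.

Context {f : R -> R}.
Hypothesis hf : is_pdf (abs_rv X) f.

Lemma abs_normal_pdf_gt0 (a b : R) : 0 < a -> a < b ->
  (0 < \int[lebesgue_measure]_(x in `[a, b]) (f x)%:E)%E.
Proof.
case: hf => mf f0 fE a0 ab; rewrite -fE//.
apply: lt_le_trans (distribution_abs_normal_itv_gt0 (ltW a0) ab) _.
apply: (@le_measure _ _ _ P); rewrite ?inE//.
- by rewrite -[_ @^-1` _]setTI; exact: measurable_funP.
- by rewrite -[_ @^-1` _]setTI; exact: measurable_funP.
by apply: preimage_subset; apply: subset_itvr; rewrite bnd_simp.
Qed.

(** The integral over the whole line is $E[|X|^p] \le E[1 + |X|]$. Default values of [powR] at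
    negative bases do no harm, since under [P] it is evaluated at $|X|$. *)
Lemma integrable_powR_abs_normal_pdf (p : R) : 0 < p -> p <= 1 ->
  lebesgue_measure.-integrable `[0, +oo[ (fun x => (x `^ p * f x)%:E).
Proof.
move=> p0 p1; have [mf f0 fE] := hf.
apply: (@integrableS _ _ _ lebesgue_measure [set: R]) => //.
apply/integrableP; split; first exact: measurable_powRM.
under eq_integral do rewrite gee0_abs ?lee_fin ?mulr_ge0 ?powR_ge0// EFinM.
have mh : measurable_fun [set: R] (fun x : R => (1 + `|x|)%:E).
  by apply/measurable_EFinP; apply: measurable_funD => //; exact: measurableT_comp.
have h0 (x : R) : (0 <= (1 + `|x|)%:E)%E by rewrite lee_fin addr_ge0.
have mpow : measurable_fun [set: R] (fun x : R => (x `^ p)%:E).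
  exact/measurable_EFinP.
rewrite (ge0_integral_pdf hf)//; last by move=> x; rewrite lee_fin powR_ge0.
apply: le_lt_trans (normal_abs_moment_lty R).
rewrite (ge0_integral_pdf is_pdf_normal)//.
apply: ge0_le_integral => //.
- by move=> t _; rewrite lee_fin powR_ge0.
- exact: (measurableT_comp mpow (measurable_funPT (abs_rv X))).
- exact: (measurableT_comp mh (measurable_funPT X)).
move=> t _ /=; rewrite lee_fin /abs_rv_fun.
have [X1|X1] := leP 1 `|X t|.
  by rewrite (le_trans (ler1_powR _ p1))// lerDr.
apply: (@le_trans _ _ 1); last by rewrite lerDl.
have := @ge0_ler_powR _ _ (ltW p0) `|X t| 1.
by rewrite powR1 !nnegrE; apply => //; exact: ltW.
Qed.

Lemma is_zstar_zstar (p : R) : 0 < p -> p <= 1 -> is_zstar f p (zstar f p).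
Proof.
move=> p0 p1; have [mf f0 _] := hf.
have ip := integrable_powR_abs_normal_pdf p0 p1.
have g0 x : 0 <= x `^ p * f x by rewrite mulr_ge0 ?powR_ge0.
(* The interval $[1,2]$ serves to show that the total mass is positive. *)
have l12 : 1 < 2 :> R by rewrite ltr1n.
have [|z z0 zE] := @exists_integral_balance R (fun x => x `^ p * f x) ip g0.
  apply: lt_le_trans (integral_powR_gt0 mf f0 abs_normal_pdf_gt0 p0 (@ltr01 R) l12) _.
  apply: ge0_subset_integral => //; first exact: measurable_powRM.
    by move=> x _; rewrite lee_fin.
  by move=> x /=; rewrite !in_itv/= andbT => /andP[x1 _]; exact: le_trans x1.
(* The solution [z] rules out the default value of [xget]. *)
by rewrite /zstar; case: xgetP => [_ -> //|/(_ z)[]].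
Qed.

End abs_normal.

Theorem proposition1 (R : realType) (d : measure_display)
    (T : measurableType d) (P : probability T R) (X : {RV P >-> R})
    (f : R -> R) (hX : standard_normal X) (hf : is_pdf (abs_rv X) f) :
  forall p q : R, 0 < p -> p < q -> q <= 1 ->
    rho_star (abs_rv X) f q < rho_star (abs_rv X) f p.
Proof.
move=> p q p0 pq q1; have [mf f0 _] := hf.
have zp : is_zstar f p (zstar f p).
  by apply: (is_zstar_zstar hX hf) => //; rewrite ltW// (lt_le_trans pq).
have zq : is_zstar f q (zstar f q).
  by apply: (is_zstar_zstar hX hf) => //; exact: lt_trans pq.
rewrite ltrD2l ltrN2; apply: (cdf_abs_normal_lt hX).
  by case: zp => /ltW.
exact: (is_zstar_lt mf f0 (abs_normal_pdf_gt0 hX hf) p0 pq zp zq).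
Qed.
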